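(* Let $k>-1$ be a real number. Then $$ \int_1^{\infty} \frac{\pi_k(t) - \pi(t^{k+1})}{t^{k+2}}\, dt = \frac{-1}{k+1}\log(k+1), $$ (the integral converging as an improper integral, i.e. $\lim_{x\to\infty}\int_1^x$), and this value is $<0$ if $k>0$ and $>0$ if $-1<k<0$.
   Context: For a real number $k$, $\pi_k(x)=\sum_{p\le x} p^k$, the sum over primes $p\le x$; $\pi(x)$ is the number of primes $\le x$. *)

(* Defs.v *)
From HB Require Import structures.
From mathcomp Require Import all_boot all_order all_algebra.
From mathcomp Require Import all_classical all_reals all_analysis.

Set Implicit Arguments.
Unset Strict Implicit.
Unset Printing Implicit Defensive.

Import Order.TTheory GRing.Theory Num.Theory.
Import numFieldNormedType.Exports.

Local Open Scope classical_set_scope.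
Local Open Scope ring_scope.

(* For p > 0, p%:R <= x iff p <= Num.truncn x, also when x is negative
   (then Num.truncn x = 0). *)
Definition primes_upto (R : realType) (x : R) : seq nat :=
  [seq p <- iota 0 (Num.truncn x).+1 | prime p].

Definition prime_pi (R : realType) (x : R) : nat := size (primes_upto x).

Definition prime_power_sum (R : realType) (k x : R) : R :=
  \sum_(p <- primes_upto x) p%:R `^ k.

(* The local integrability clause is needed because \int is a total operation,
   with a default value on non-integrable functions. *)
Definition improper_integral_eq (R : realType) (f : R -> R) (a v : R) : Prop :=
  (forall x : R, (@lebesgue_measure R).-integrable `[a, x] (EFin \o f)) /\
  (\int[@lebesgue_measure R]_(t in `[a, x]) f t) @[x --> +oo] --> v.

(* Main.v *)
(** With m = k + 1 and P(x) the sum of 1/p over primes p <= x, integrating the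
    step functions term by term gives
      m * \int_1^x = P(x) - P(x^m) - pi_k(x) / x^m + pi(x^m) / x^m.
    By Mertens' second theorem P(x) - ln (ln x) converges, so that
    P(x) - P(x^m) tends to - ln m. The two remaining terms tend to 0 for the same
    reason: p^c / x^(c+1) <= 1/p for p <= x, the primes below x^d contribute
    little for d < 1, and those above at most P(x) - P(x^d), which tends to
    - ln d. Mertens' theorem is obtained from the factorization of n! and the
    bound 4^n on the primorial. *)

Require Import Defs.
From HB Require Import structures.
From mathcomp Require Import all_boot all_order all_algebra.
From mathcomp Require Import all_classical all_reals all_analysis.
From mathcomp Require Import zify ring lra.

Set Implicit Arguments.
Unset Strict Implicit.
Unset Printing Implicit Defensive.

Import Order.TTheory GRing.Theory Num.Theory.
Import numFieldNormedType.Exports.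

Local Open Scope classical_set_scope.
Local Open Scope ring_scope.

(** * Binomial coefficients and the primorial bound *)

(** Distinct primes are coprime, so Gauss's lemma combines the divisibilities. This serves to bound
    a product of primes by a binomial coefficient that they all divide. *)
Lemma prod_uniq_primes_dvdn (s : seq nat) n :
  uniq s -> {in s, forall p, prime p && (p %| n)%N} -> (\prod_(p <- s) p %| n)%N.
Proof.
elim: s => [|p s IH] /=; first by rewrite big_nil.
move=> /andP[ps us] H; rewrite big_cons.
have /andP[pp pn] := H p (mem_head _ _).
rewrite Gauss_dvd; last first.
  rewrite prime_coprime //; apply/negP.
  rewrite Euclid_dvd_prod // big_has => /hasP[q qs pq].
  move: (H q); rewrite inE qs orbT => /(_ isT)/andP[pq' _].
  by move: pq; rewrite dvdn_prime2 // => /eqP pq; rewrite pq qs in ps.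
rewrite pn IH // => q qs; apply: H.
by rewrite inE qs orbT.
Qed.

Lemma prime_dvdn_fact p n : prime p -> (p %| n`!)%N = (p <= n)%N.
Proof.
move=> pp; apply/idP/idP => [|pn]; last by rewrite dvdn_fact // prime_gt0.
elim: n => [|n IH]; first by rewrite fact0 dvdn1 => /eqP p1; rewrite p1 in pp.
rewrite factS Euclid_dvdM // => /orP[/dvdn_leq -> //|/IH].
exact: leqW.
Qed.

(** Row 2m+1 of Pascal's triangle sums to 2 * 4^m and contains this coefficient twice, at m and at
    m+1. *)
Lemma bin_center_odd_le m : ('C(m.*2.+1, m) <= 4 ^ m)%N.
Proof.
have H : (2 ^ m.*2.+1 = \sum_(i < m.*2.+2) 'C(m.*2.+1, i))%N.
  rewrite -[2%N]/(1 + 1)%N expnDn; apply: eq_bigr => i _.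
  by rewrite !exp1n !muln1.
have m1 : (m < m.*2.+2)%N by lia.
have m2 : (m.+1 < m.*2.+2)%N by lia.
rewrite (bigD1 (Ordinal m1)) //= (bigD1 (Ordinal m2)) /= in H; last first.
  by rewrite -val_eqE /=; lia.
have E : 'C(m.*2.+1, m.+1) = 'C(m.*2.+1, m).
  rewrite -bin_sub; last by lia.
  by congr 'C(_, _); lia.
have E4 : (2 ^ m.*2.+1 = 2 * 4 ^ m)%N by rewrite expnS -mul2n expnM.
by rewrite E4 E addnA addnn -mul2n in H; lia.
Qed.

(** Erdős's argument, by strong induction. An even n > 2 adds no prime; for n = 2m+1 the primes up
    to m+1 give at most 4^(m+1), and the remaining ones divide C(2m+1, m) <= 4^m. *)
Lemma primorial_le n : (\prod_(0 <= p < n.+1 | prime p) p <= 4 ^ n)%N.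
Proof.
elim/ltn_ind: n => n IH.
case: n IH => [|[|[|n]]] IH; try by rewrite unlock.
have [on|en] := boolP (odd n.+3); last first.
  rewrite big_mkcond big_nat_recr //= -big_mkcond ifF; last first.
    apply/negP => pn; move: en.
    by have [/eqP|->] := even_prime pn.
  rewrite muln1; apply: leq_trans (IH n.+2 _) _ => //.
  by rewrite leq_exp2l.
have [m Em] : exists m, n.+3 = m.*2.+1.
  by exists n.+3./2; rewrite -[LHS]odd_double_half on.
have m0 : (0 < m)%N by lia.
rewrite Em (@big_cat_nat _ _ _ m.+2) //=; last by lia.
apply: leq_trans (_ : (4 ^ m.+1 * 4 ^ m <= _)%N); last first.
  by rewrite -expnD leq_exp2l //; lia.
apply: leq_mul; first by apply: IH; lia.
apply: leq_trans (bin_center_odd_le m).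
apply: dvdn_leq; first by rewrite bin_gt0; lia.
rewrite -big_filter; apply: prod_uniq_primes_dvdn.
  by rewrite filter_uniq // iota_uniq.
move=> p; rewrite mem_filter mem_index_iota => /andP[pp /andP[p1 p2]].
rewrite pp /=.
(* Since p > m+1, it divides neither m! nor (m+1)!, so it must divide the binomial coefficient. *)
have : (p %| (m.*2.+1)`!)%N by rewrite prime_dvdn_fact.
rewrite -(@bin_fact _ m); last by lia.
rewrite !Euclid_dvdM // !prime_dvdn_fact // => /or3P[//||]; lia.
Qed.

(** * Chebyshev's theta function and the factorization of n! *)

Section Chebyshev.
Variable R : realType.

Definition theta (n : nat) : R := \sum_(0 <= p < n.+1 | prime p) ln p%:R.

Definition log_recip_sum (n : nat) : R :=
  \sum_(0 <= p < n.+1 | prime p) ln p%:R / p%:R.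

Definition prime_recip_sum (n : nat) : R :=
  \sum_(0 <= p < n.+1 | prime p) p%:R^-1.

Lemma ln_prod_nat (s : seq nat) (P : pred nat) (F : nat -> nat) :
  (forall i, P i -> (0 < F i)%N) ->
  ln (\prod_(i <- s | P i) F i)%:R = \sum_(i <- s | P i) ln (F i)%:R :> R.
Proof.
(* Positivity of the product is carried through the induction, since [lnM] requires positive
   factors. *)
move=> F0; suff [] : (0 < \prod_(i <- s | P i) F i)%N /\
  ln (\prod_(i <- s | P i) F i)%:R = \sum_(i <- s | P i) ln (F i)%:R :> R by [].
elim/big_rec2 : _ => [|i y x Pi [x0 IH]]; first by rewrite ln1.
split; first by rewrite muln_gt0 F0.
by rewrite natrM lnM ?posrE ?ltr0n ?F0 // IH.
Qed.

Lemma theta_le n : theta n <= ln 4%:R * n%:R.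
Proof.
rewrite /theta -ln_prod_nat => [|p /prime_gt0//].
have -> : ln 4%:R * n%:R = ln (4 ^ n)%:R :> R.
  by rewrite natrX lnXn ?ltr0n // mulr_natr.
rewrite ler_ln ?posrE ?ltr0n ?expn_gt0 // ?ler_nat ?primorial_le //.
by apply: prodn_cond_gt0 => p /prime_gt0.
Qed.

(** The range extends to N, the extra exponents being 0, so that the identities for all factors of a
    factorial share one index set. *)
Lemma ln_nat_prime_sum N n : (0 < n <= N)%N ->
  ln n%:R = \sum_(0 <= p < N.+1 | prime p) (logn p n)%:R * ln p%:R :> R.
Proof.
move=> /andP[n0 nN]; rewrite -{1}(partnT n0) (widen_partn _ nN).
rewrite ln_prod_nat; last by move=> p _; exact: pfactor_gt0.
rewrite big_mkcond [RHS]big_mkcond /=; apply: eq_bigr => p _.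
case: ifPn => pp.
  by rewrite natrX lnXn ?ltr0n ?prime_gt0 // mulr_natl.
by rewrite lognE (negbTE pp) expn0 ln1.
Qed.

Lemma ln_fact_prime_sum n :
  ln (n`!)%:R = \sum_(0 <= p < n.+1 | prime p) (logn p n`!)%:R * ln p%:R :> R.
Proof.
suff H : forall j, (j <= n)%N ->
  ln (j`!)%:R = \sum_(0 <= p < n.+1 | prime p) (logn p j`!)%:R * ln p%:R :> R.
  exact: H.
elim=> [|j IH] jn.
  by rewrite ln1 big1 // => p _; rewrite logn1 mul0r.
rewrite factS natrM lnM ?posrE ?ltr0n ?fact_gt0 // IH; last exact: ltnW.
rewrite (@ln_nat_prime_sum n) // -big_split /=; apply: eq_bigr => p pp.
by rewrite lognM ?fact_gt0 // natrD mulrDl.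
Qed.

(** Only the first term, the floor of n/p, of Legendre's formula is kept. *)
Lemma logn_fact_ge p n : prime p -> n%:R / p%:R - 1 <= (logn p n`!)%:R :> R.
Proof.
move=> pp; have p0 : 0 < p%:R :> R by rewrite ltr0n prime_gt0.
case: n => [|n]; first by rewrite mul0r sub0r (le_trans _ (ler0n _ _)) // lerN10.
rewrite lerBlDr ler_pdivrMr // natr1 -natrM ler_nat.
rewrite logn_fact // big_ltn // expn1.
have := ltn_pmod n.+1 (prime_gt0 pp).
rewrite {2}(divn_eq n.+1 p) mulSnr mulnDl => lt_mod.
by rewrite -addnA leq_add2l (leq_trans (ltnW lt_mod)) // leq_addl.
Qed.

(** Without the floors, Legendre's formula is dominated by a geometric series of sum n/(p-1). *)
Lemma logn_fact_le p n : prime p -> (logn p n`!)%:R * (p%:R - 1) <= n%:R :> R.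
Proof.
move=> pp; have p0 : 0 < p%:R :> R by rewrite ltr0n prime_gt0.
have p1 : 1 < p%:R :> R by rewrite ltr1n prime_gt1.
rewrite logn_fact //.
(* The exact partial sum of the geometric series makes the induction go through. *)
suff H : forall m, (\sum_(1 <= k < m.+1) n %/ p ^ k)%:R * (p%:R - 1)
      <= n%:R * (1 - (p%:R ^+ m)^-1) :> R.
  apply: le_trans (H n) _; rewrite ler_piMr // gerBl invr_ge0 exprn_ge0 //.
elim=> [|m IH].
  by rewrite big_geq // expr0 invr1 subrr mul0r mulr0.
rewrite big_nat_recr //= natrD mulrDl.
have : (n %/ p ^ m.+1)%:R <= n%:R * (p%:R ^+ m.+1)^-1 :> R.
  rewrite ler_pdivlMr ?exprn_gt0 // -natrX -natrM ler_nat.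
  exact: leq_divM.
rewrite exprS invfM.
have : p%:R^-1 * p%:R = 1 :> R by rewrite mulVf // gt_eqF.
set q := p%:R^-1; set t := (_ ^+ m)^-1 in IH *.
move=> qp H.
have : (n %/ p ^ m.+1)%:R * (p%:R - 1) <= n%:R * (q * t) * (p%:R - 1) :> R.
  by apply: ler_wpM2r => //; rewrite subr_ge0 ltW.
have -> : n%:R * (q * t) * (p%:R - 1) = n%:R * t * (q * p%:R) - n%:R * (q * t) :> R by ring.
rewrite qp; move: IH; lra.
Qed.

End Chebyshev.

(** * Mertens' first theorem, and the second at integers *)

Section Mertens.
Variable R : realType.
Local Notation A := (@log_recip_sum R).
Local Notation S := (@prime_recip_sum R).

(** This is ln (1 + u) <= u at u = (b-a)/a. Exchanging a and b gives the lower bound (b-a)/b for the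
    same difference. *)
Lemma lnB_le (a b : R) : 0 < a -> 0 < b -> ln b - ln a <= (b - a) / a.
Proof.
move=> a0 b0; rewrite -ln_div ?posrE //.
have -> : b / a = 1 + (b - a) / a by field; rewrite gt_eqF.
apply: le_ln1Dx; rewrite ltr_pdivlMr //; lra.
Qed.

Lemma ln_succB_ge0 n : (0 < n)%N -> 0 <= ln n.+1%:R - ln n%:R :> R.
Proof.
by move=> n0; rewrite subr_ge0 ler_ln ?posrE ?ltr0n // ler_nat.
Qed.

Lemma ln_succB_le n : (0 < n)%N -> n%:R * (ln n.+1%:R - ln n%:R) <= 1 :> R.
Proof.
move=> n0; have n0' : 0 < n%:R :> R by rewrite ltr0n.
rewrite mulrC -ler_pdivlMr //.
have := @lnB_le n%:R n.+1%:R n0' (ltr0Sn _ _).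
by rewrite -natr1 addrAC subrr add0r.
Qed.

Lemma ln_succB_le1 n : (0 < n)%N -> ln n.+1%:R - ln n%:R <= 1 :> R.
Proof.
move=> n0; apply: le_trans (ln_succB_le n0).
by rewrite ler_peMl ?ln_succB_ge0 // ler1n.
Qed.

Lemma ln_fact_le n : ln (n`!)%:R <= n%:R * ln n%:R :> R.
Proof.
have [->|n0] := posnP n; first by rewrite ln1 mul0r.
rewrite mulr_natl -lnXn ?ltr0n // -natrX.
rewrite ler_ln ?posrE ?ltr0n ?fact_gt0 ?expn_gt0 ?n0 // ler_nat.
rewrite fact_prod -[X in (_ <= _ ^ X)%N](@subn1 n.+1) -prod_nat_const_nat.
by rewrite big_nat [leqRHS]big_nat leq_prod // => i /andP[].
Qed.

(** The weak Stirling bound n! >= (n/e)^n; the induction step amounts to (1 + 1/n)^n <= e. *)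
Lemma ln_fact_ge n : (0 < n)%N ->
  n%:R * ln n%:R - n%:R <= ln (n`!)%:R :> R.
Proof.
elim: n => // n IH _.
have [->|n0] := posnP n; first by rewrite ln1; lra.
have := IH n0; have := ln_succB_le n0.
rewrite factS natrM lnM ?posrE ?ltr0n ?fact_gt0 // -natr1.
set L := ln (_ + 1); set l := ln n%:R; nra.
Qed.

(* The summand is exactly dominated by the telescoping difference of
   [(ln n + 2) / n]. *)
Lemma sum_log_prime_pair_le n : (0 < n)%N ->
  \sum_(0 <= p < n.+1 | prime p) ln p%:R / (p%:R * (p%:R - 1))
    <= 2 - (ln n%:R + 2) / n%:R :> R.
Proof.
elim: n => // n IH _.
have [->|n0] := posnP n; first by rewrite unlock /= ln1; lra.
have x0 : 0 < n%:R :> R by rewrite ltr0n.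
have step : ln n.+1%:R / (n.+1%:R * (n.+1%:R - 1))
   <= (ln n%:R + 2) / n%:R - (ln n.+1%:R + 2) / n.+1%:R :> R.
  have := ln_succB_le n0; have := ln_succB_le1 n0.
  rewrite -natr1; set L := ln (_ + 1); set l := ln n%:R; set x := n%:R in x0 *.
  move=> h1 h2; rewrite -subr_ge0.
  have -> : (l + 2) / x - (L + 2) / (x + 1) - L / ((x + 1) * (x + 1 - 1)) =
    (2 - x * (L - l) - (L - l)) / (x * (x + 1)).
    by field; rewrite !gt_eqF //; lra.
  by apply: divr_ge0; [lra | apply: mulr_ge0; lra].
have l0 : 0 <= ln n.+1%:R / (n.+1%:R * (n.+1%:R - 1)) :> R.
  apply: divr_ge0; first by rewrite ln_ge0 // ler1n.
  by apply: mulr_ge0; rewrite ?subr_ge0 ?ler1n.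
have := IH n0; rewrite big_mkcond [X in _ -> X <= _]big_mkcond /=.
rewrite [X in _ -> X <= _]big_nat_recr //= => h.
apply: le_trans (_ : _ <= 2 - (ln n%:R + 2) / n%:R +
  ((ln n%:R + 2) / n%:R - (ln n.+1%:R + 2) / n.+1%:R)) _; last first.
  by rewrite addrA subrK.
apply: lerD h _; case: ifP => _ //; exact: le_trans l0 step.
Qed.

(** Mertens' first theorem: ln n! lies between n ln n - n and n ln n, and its expansion over primes
    is close to n times [A n]. *)
Lemma mertens1 n : (0 < n)%N -> `|A n - ln n%:R| <= 4.
Proof.
move=> n0; have x0 : 0 < n%:R :> R by rewrite ltr0n.
(* The loss of 1 in each exponent of n! adds up to [theta R n], at most n ln 4 <= 4n. *)
have ub : n%:R * A n <= n%:R * (ln n%:R + 4).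
  apply: (@le_trans _ _ (ln (n`!)%:R + theta R n)).
    rewrite ln_fact_prime_sum -big_split /= mulr_sumr; apply: ler_sum => p pp.
    have := logn_fact_ge R n pp; have : 0 <= ln p%:R :> R.
      by rewrite ln_ge0 // ler1n prime_gt0.
    move=> l0 h; have := ler_wpM2r l0 h; lra.
  have := ln_fact_le n; have := theta_le R n.
  have : ln 4%:R * n%:R <= 4 * n%:R :> R.
    by rewrite ler_wpM2r ?ler0n // ltW // ln_sublinear.
  lra.
(* Here 1/(p-1) = 1/p + 1/(p(p-1)); the second part, weighted by ln p, sums to at most 2. *)
have lb : n%:R * (ln n%:R - 1) <= n%:R * (A n + 2).
  apply: (@le_trans _ _ (ln (n`!)%:R)); first by have := ln_fact_ge n0; lra.
  have H2 := sum_log_prime_pair_le n0.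
  have H3 : 0 <= (ln n%:R + 2) / n%:R :> R.
    by apply: divr_ge0; rewrite ?addr_ge0 // ln_ge0 // ler1n.
  apply: (@le_trans _ _ (n%:R * (A n +
    \sum_(0 <= p < n.+1 | prime p) ln p%:R / (p%:R * (p%:R - 1))))); last first.
    by apply: ler_wpM2l => //; lra.
  rewrite -big_split /= mulr_sumr ln_fact_prime_sum; apply: ler_sum => p pp.
  have p1 : 1 < p%:R :> R by rewrite ltr1n prime_gt1.
  have -> : n%:R * (ln p%:R / p%:R + ln p%:R / (p%:R * (p%:R - 1)))
    = n%:R / (p%:R - 1) * ln p%:R :> R by field; rewrite !gt_eqF; lra.
  apply: ler_wpM2r; first by rewrite ln_ge0 // ltW.
  rewrite ler_pdivlMr ?subr_gt0 //.
  exact: logn_fact_le.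
rewrite ler_pM2l // in ub; rewrite ler_pM2l // in lb.
rewrite ler_norml; lra.
Qed.

(** Both sides vanish unless n+1 is prime, and then ln (n+1) is nonzero; the zero denominator at n =
    0 thus does no harm. *)
Lemma prime_recip_sumS n :
  S n.+1 - S n = (A n.+1 - A n) / ln n.+1%:R.
Proof.
have E (F : nat -> R) : \sum_(0 <= p < n.+2 | prime p) F p -
    \sum_(0 <= p < n.+1 | prime p) F p = if prime n.+1 then F n.+1 else 0.
  rewrite big_mkcond [X in _ - X]big_mkcond big_nat_recr //=; lra.
rewrite !E; case: ifP => pn; last by rewrite mul0r.
have : ln n.+1%:R != 0 :> R by rewrite gt_eqF // ln_gt0 // ltr1n prime_gt1.
by move=> l0; rewrite mulrAC divff // mul1r.
Qed.

(* What partial summation of [1/p = (ln p / p) / ln p] leaves after removal of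
   the boundary term and of [ln ln n]. *)
Definition mertens2_core (n : nat) : R :=
  S n - (A n - ln n%:R) / ln n%:R - ln (ln n%:R).

(** Of the constant 5, 4 comes from the bound on [A n - ln n%:R], and 1 from comparing the increment
    of ln ln with (L - l)/L, where l = ln n, L = ln (n+1) and L - l <= 1. *)
Lemma mertens2_core_step n : (1 < n)%N ->
  `|mertens2_core n.+1 - mertens2_core n|
    <= 5 * ((ln n%:R)^-1 - (ln n.+1%:R)^-1).
Proof.
move=> n1; have n0 : (0 < n)%N by apply: ltnW.
have l0 : 0 < ln n%:R :> R by rewrite ln_gt0 // ltr1n.
have L0 : 0 < ln n.+1%:R :> R by rewrite ln_gt0 // ltr1n.
have Ll := ln_succB_ge0 n0; have Ll1 := ln_succB_le1 n0.
have h1 := lnB_le l0 L0; have h2 := lnB_le L0 l0.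
have /ler_normlP[D1 D2] := mertens1 n0.
have := prime_recip_sumS n; rewrite ler_norml /mertens2_core.
set l := ln n%:R in l0 Ll Ll1 h1 h2 D1 D2 *.
set L := ln n.+1%:R in L0 Ll Ll1 h1 h2 *.
set a := A n in D1 D2 *; set b := A n.+1; set D := a - l in D1 D2.
move=> SE.
have -> : S n.+1 - (b - L) / L - ln L - (S n - (a - l) / l - ln l) =
  (S n.+1 - S n) + ((L - l) / L + D * (l^-1 - L^-1) - (b - a) / L - (ln L - ln l)).
  by rewrite /D; field; rewrite !gt_eqF.
rewrite SE.
have d0 : 0 <= l^-1 - L^-1 by rewrite subr_ge0 lef_pV2 ?posrE //; lra.
have : (L - l) / l - (L - l) / L <= l^-1 - L^-1.
  by rewrite -mulrBr ler_piMl.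
have -> : (L - l) / L = - ((l - L) / L) by ring.
have := ler_wpM2r d0 D1; have := ler_wpM2r d0 D2.
set d := _ - _ in d0 *; lra.
Qed.

Lemma cvgr_ln : @ln R x @[x --> +oo] --> +oo.
Proof.
apply/cvgryPge => a; near=> x.
have x0 : 0 < x by near: x; exact: nbhs_pinfty_gt.
have xa : expR a <= x by near: x; exact: nbhs_pinfty_ge.
by rewrite -[a]expRK ler_ln ?posrE ?expR_gt0.
Unshelve. all: by end_near. Qed.

Lemma cvgr_inv_ln : (@ln R x)^-1 @[x --> +oo] --> (0 : R).
Proof.
apply/gtr0_cvgV0; last exact: cvgr_ln.
by near=> x; rewrite ln_gt0 //; near: x; exact: nbhs_pinfty_gt.
Unshelve. all: by end_near. Qed.

Lemma cvgn_inv_ln : (ln (n.+2%:R : R))^-1 @[n --> \oo] --> (0 : R).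
Proof.
apply: (@cvg_comp _ _ _ (fun n => n.+2%:R : R) (fun x : R => (ln x)^-1) _ +oo);
  last exact: cvgr_inv_ln.
by have := @cvgr_idn R; rewrite -(cvg_shiftn 2) /=; under eq_fun do rewrite addn2.
Qed.

(** The steps have a telescoping bound, so adding 5/ln makes the sequence nonincreasing and
    subtracting it makes it nondecreasing; the second bounds the first below. The shift by 2 keeps
    the logarithm positive. *)
Lemma mertens2_core_cvg : cvgn (fun n => mertens2_core n.+2).
Proof.
pose v n : R := (ln n.+2%:R)^-1.
pose u n := mertens2_core n.+2 + 5 * v n.
pose w n := mertens2_core n.+2 - 5 * v n.
have v0 n : 0 <= v n by rewrite invr_ge0 ln_ge0 // ler1n.
have step n : `|mertens2_core n.+3 - mertens2_core n.+2| <= 5 * (v n - v n.+1).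
  exact: mertens2_core_step.
have udecr : nonincreasing_seq u.
  by apply/nonincreasing_seqP => n; have := step n; rewrite ler_norml /u; lra.
have wincr : nondecreasing_seq w.
  by apply/nondecreasing_seqP => n; have := step n; rewrite ler_norml /w; lra.
have ucvg : cvgn u.
  apply: nonincreasing_is_cvgn => //; exists (w 0%N) => _ [n _ <-].
  by apply: (le_trans (wincr _ _ (leq0n n))); rewrite /u /w; have := v0 n; lra.
have -> : (fun n => mertens2_core n.+2) = u \- (fun n => 5 * v n).
  by apply/funext => n; rewrite /u /= addrK.
by apply: is_cvgB => //; apply: is_cvgMl_tmp; apply: cvgP cvgn_inv_ln.
Qed.

(** The boundary term removed in [mertens2_core] is at most 4/ln n by [mertens1], hence tends to
    0. *)
Lemma mertens2n : exists B : R, S n.+2 - ln (ln n.+2%:R) @[n --> \oo] --> B.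
Proof.
have /cvg_ex [B cB] := mertens2_core_cvg.
exists (B + 0).
have -> : (fun n => S n.+2 - ln (ln n.+2%:R)) = (fun n => mertens2_core n.+2 +
    (A n.+2 - ln n.+2%:R) / ln n.+2%:R).
  by apply/funext => n; rewrite /mertens2_core; lra.
apply: cvgD cB _.
apply/norm_cvg0P.
apply: (@squeeze_cvgr _ _ _ _ (fun=> 0) (fun n => 4 * (ln n.+2%:R)^-1)).
- near=> n; rewrite normr_ge0 normrM /=.
  have l0 : 0 <= (ln n.+2%:R)^-1 :> R by rewrite invr_ge0 ln_ge0 // ler1n.
  by rewrite (ger0_norm l0) ler_wpM2r // mertens1.
- exact: cvg_cst.
- by rewrite -[X in _ --> X](mulr0 4); apply: cvgMl_tmp; exact: cvgn_inv_ln.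
Unshelve. all: by end_near. Qed.

End Mertens.

(** * Mertens' second theorem at real arguments, and the vanishing of normalized prime power sums *)

Section PrimeSums.
Variable R : realType.
Local Notation S := (@prime_recip_sum R).
Local Notation P x := (S (Num.truncn (x : R))).

Lemma primes_upto_sum (F : nat -> R) (x : R) :
  \sum_(p <- primes_upto x) F p =
  \sum_(0 <= p < (Num.truncn x).+1 | prime p) F p.
Proof. by rewrite /primes_upto big_filter. Qed.

Lemma cvgr_truncn : ((Num.truncn (x : R))%:R : R) @[x --> +oo] --> +oo.
Proof.
apply/cvgryPge => a; near=> x.
have xa : a + 1 <= x by near: x; exact: nbhs_pinfty_ge (num_real _).
have := truncnS_gt x; rewrite -natr1; lra.
Unshelve. all: by end_near. Qed.

(** The prime sum depends only on the integer part T of x, and 0 <= ln ln x - ln ln T <= 1/ln T. *)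
Lemma mertens2 : exists B : R, P x - ln (ln x) @[x --> +oo] --> B.
Proof.
have [B cB] := mertens2n R; exists (B + 0).
pose T (x : R) : R := (Num.truncn x)%:R.
have c1 : P x - ln (ln (T x)) @[x --> +oo] --> B.
  (* Subtracting 2 undoes the shift of the sequence once x >= 2. *)
  have : (fun n => S n.+2 - ln (ln n.+2%:R)) (Num.truncn (x : R) - 2)%N @[x --> +oo] --> B.
    suff c : (Num.truncn (x : R) - 2)%N @[x --> +oo] --> \oo.
      exact: cvg_comp _ _ c cB.
    apply/cvgnyPge => N; near=> x; rewrite leq_subRL.
      rewrite truncn_ge_nat; first by near: x; exact: nbhs_pinfty_ge (num_real _).
      by near: x; exact: nbhs_pinfty_ge (num_real _).
    rewrite truncn_ge_nat; first by near: x; exact: nbhs_pinfty_ge (num_real _).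
    by near: x; exact: nbhs_pinfty_ge (num_real _).
  apply: cvg_trans; apply: near_eq_cvg; near=> x.
  have x2 : 2 <= x by near: x; exact: nbhs_pinfty_ge (num_real _).
  have n2 : (2 <= Num.truncn x)%N by rewrite truncn_ge_nat //; lra.
  by rewrite /T /=; case: (Num.truncn x) n2 => [|[|n]] // _; rewrite subSS subSS subn0.
have c2 : ln (ln x) - ln (ln (T x)) @[x --> +oo] --> (0 : R).
  apply: (@squeeze_cvgr _ _ _ _ (fun=> 0) (fun x => (ln (T x))^-1)).
  - near=> x.
    have x2 : 2 <= x by near: x; exact: nbhs_pinfty_ge (num_real _).
    have n2 : 2 <= T x by rewrite ler_nat truncn_ge_nat //; lra.
    have := truncnS_gt x; have : T x <= x by rewrite truncn_le; lra.
    rewrite -natr1 -/(T x) => Tx xT.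
    have l0 : 0 < ln (T x) by rewrite ln_gt0; lra.
    have lx : ln (T x) <= ln x by rewrite ler_ln ?posrE; lra.
    have L0 : 0 < ln x by lra.
    apply/andP; split; first by rewrite subr_ge0 ler_ln.
    move/le_trans: (lnB_le l0 L0); apply.
    rewrite ler_piMl ?invr_ge0 ?(ltW l0) //.
    have T0 : 0 < T x by lra.
    have X0 : 0 < x by lra.
    apply: le_trans (lnB_le T0 X0) _.
    by rewrite ler_pdivrMr; lra.
  - exact: cvg_cst.
  - exact: (cvg_comp T (fun y => (ln y)^-1) cvgr_truncn (@cvgr_inv_ln R)).
have -> : (fun x => P x - ln (ln x)) = (fun x => P x - ln (ln (T x)) -
   (ln (ln x) - ln (ln (T x)))).
  by apply/funext => x; lra.
by rewrite -(subr0 (B + 0)) addr0; exact: cvgB.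
Unshelve. all: by end_near. Qed.

Lemma cvgr_powR (e : R) : 0 < e -> x `^ e @[x --> +oo] --> +oo.
Proof.
move=> e0; apply/cvgryPge => a; near=> x.
have x0 : 0 < x by near: x; exact: nbhs_pinfty_gt (num_real _).
have lx : a / e <= ln x.
  by near: x; move/cvgryPge: (@cvgr_ln R) => /(_ (a / e)).
rewrite ler_pdivrMr // mulrC -ln_powR in lx.
by apply: le_trans lx _; rewrite ltW // ln_sublinear // powR_gt0.
Unshelve. all: by end_near. Qed.

(** From ln y < y at y = x^(b/2), the product is at most (2/b) x^(-b/2). *)
Lemma cvgr_ln_powR (b : R) : 0 < b -> x `^ (- b) * ln x @[x --> +oo] --> 0.
Proof.
move=> b0; have b20 : 0 < b / 2 by rewrite divr_gt0.
apply: (@squeeze_cvgr _ _ _ _ (fun=> 0) (fun x => (b / 2)^-1 * (x `^ (b / 2))^-1)).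
- near=> x.
  have x1 : 1 < x by near: x; exact: nbhs_pinfty_gt (num_real _).
  have x0 : 0 < x by lra.
  rewrite mulr_ge0 ?powR_ge0 ?ln_ge0 ?(ltW x1) //=.
  have h : ln x <= (b / 2)^-1 * x `^ (b / 2).
    rewrite ler_pdivlMl // -ln_powR ltW // ln_sublinear // powR_gt0 //.
  apply: le_trans (ler_wpM2l (powR_ge0 _ _) h) _.
  have -> : - b = - (b / 2) + - (b / 2) by field.
  rewrite powRD; last by rewrite (gt_eqF x0) implybT.
  rewrite !powRN; set q := x `^ _.
  have q0 : q != 0 by rewrite gt_eqF // powR_gt0.
  by rewrite le_eqVlt; apply/orP; left; apply/eqP; field; rewrite q0 gt_eqF.
- exact: cvg_cst.
- rewrite -[X in _ --> X](mulr0 (b / 2)^-1); apply: cvgMl_tmp.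
  apply/gtr0_cvgV0; last exact: cvgr_powR.
  near=> x; rewrite powR_gt0 //; near: x; exact: nbhs_pinfty_gt (num_real _).
Unshelve. all: by end_near. Qed.

(** The Mertens constants cancel, and ln ln (x^m) = ln m + ln ln x for x > 1. *)
Lemma prime_recip_sum_powR (m : R) : 0 < m ->
  P x - P (x `^ m) @[x --> +oo] --> - ln m.
Proof.
move=> m0; have [B cB] := mertens2.
have cBm := cvg_comp _ _ (cvgr_powR m0) cB.
have : (P x - ln (ln x)) - (P (x `^ m) - ln (ln (x `^ m))) - ln m @[x --> +oo]
    --> B - B - ln m.
  apply: cvgB; last exact: cvg_cst.
  exact: cvgB cB cBm.
rewrite subrr sub0r; apply: cvg_trans; apply: near_eq_cvg; near=> x.
have x1 : 1 < x by near: x; exact: nbhs_pinfty_gt (num_real _).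
by rewrite /= ln_powR lnM ?posrE ?ln_gt0 //; ring.
Unshelve. all: by end_near. Qed.

(** A crude harmonic bound from 1/(n+1) <= ln (n+1) - ln n; it suffices because it gets multiplied
    by a negative power of x. *)
Lemma prime_recip_sum_le_ln n : (0 < n)%N -> S n <= ln n%:R.
Proof.
elim: n => // n IH _.
have [->|n0] := posnP n; first by rewrite ln1 /prime_recip_sum unlock.
have h : n.+1%:R^-1 <= ln n.+1%:R - ln n%:R :> R.
  have := @lnB_le R n.+1%:R n%:R (ltr0Sn _ _); rewrite ltr0n n0 => /(_ isT).
  have -> : n%:R - n.+1%:R = -1 :> R by rewrite -natr1; ring.
  by rewrite mulN1r -opprB lerN2.
have := IH n0; rewrite /prime_recip_sum big_mkcond => {}IH.
rewrite big_mkcond big_nat_recr //=; case: ifP => _; last first.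
  by rewrite addr0 (le_trans IH) // -subr_ge0 ln_succB_ge0.
by rewrite -[leRHS](subrKC (ln n%:R)) lerD.
Qed.

Lemma prime_recip_sum_homo n n' : (n <= n')%N -> S n <= S n'.
Proof.
move=> nn; rewrite /prime_recip_sum (@big_cat_nat _ _ _ n.+1 0 n'.+1) //=.
by rewrite lerDl sumr_ge0.
Qed.

(* Write [p^c / x^(c+1) = (p/x)^(c+1) / p] and cut the sum at [x^d]. *)
Lemma prime_power_sum_le (c d x : R) : 0 < c + 1 -> 0 < d < 1 -> 1 <= x ->
  prime_power_sum c x / x `^ (c + 1) <=
  x `^ (- ((1 - d) * (c + 1))) * ln x + (P x - P (x `^ d)).
Proof.
move=> c0 /andP[d0 d1] x1; have x0 : 0 < x by lra.
pose z := x `^ d; have z0 : 0 < z by rewrite powR_gt0.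
have z1 : 1 <= z by rewrite -(powRr0 x) ler_powR // (ltW d0).
have zx : z <= x by rewrite ler1_powR // (ltW d1).
have MN : (Num.truncn z <= Num.truncn x)%N by exact: le_truncn.
have N1 : (0 < Num.truncn x)%N by rewrite truncn_gt0.
set q := x `^ (- _).
have q0 : 0 <= q by rewrite powR_ge0.
have Eq : q = (z / x) `^ (c + 1).
  have -> : z / x = x `^ (d - 1).
    by rewrite powRB ?(gt_eqF x0) ?implybT // powRr1 // ltW.
  by rewrite -powRrM; congr (_ `^ _); ring.
have Ep p : prime p -> p%:R `^ c / x `^ (c + 1) = (p%:R / x) `^ (c + 1) * p%:R^-1.
  move=> pp; have p0 : 0 < p%:R :> R by rewrite ltr0n prime_gt0.
  have -> : (p%:R / x) `^ (c + 1) = p%:R `^ (c + 1) / x `^ (c + 1).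
    rewrite powRM ?invr_ge0 ?ler0n ?(ltW x0) //.
    by rewrite -(powR_inv1 (ltW x0)) -powRrM mulN1r powRN.
  rewrite [X in _ = X / _ / _]powRD ?(gt_eqF p0) ?implybT // powRr1 ?(ltW p0) //.
  by field; rewrite !gt_eqF ?powR_gt0.
have mono (p : nat) (y : R) : p%:R <= y ->
    (p%:R / x) `^ (c + 1) <= (y / x) `^ (c + 1).
  move=> py; apply: ge0_ler_powR; rewrite ?nnegrE ?divr_ge0 ?ler0n ?(ltW x0) ?(ltW c0) //.
    exact: le_trans (ler0n _ p) py.
  by rewrite ler_pM2r ?invr_gt0.
rewrite /prime_power_sum primes_upto_sum mulr_suml.
rewrite (eq_bigr _ Ep) (@big_cat_nat _ _ _ (Num.truncn z).+1) //=.
have split : P x - P z = \sum_((Num.truncn z).+1 <= p < (Num.truncn x).+1 | prime p) p%:R^-1.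
  by rewrite /prime_recip_sum (@big_cat_nat _ _ _ (Num.truncn z).+1 0 (Num.truncn x).+1) //= addrAC subrr add0r.
(* Up to x^d the factor (p/x)^(c+1) is at most q and the reciprocals sum to at most ln x; beyond x^d
   the factor is at most 1. *)
apply: lerD.
  apply: (@le_trans _ _ (q * P z)).
    rewrite mulr_sumr big_nat_cond [leRHS]big_nat_cond.
    apply: ler_sum => p /andP[/andP[_ pz] pp].
    rewrite ler_wpM2r ?invr_ge0 ?ler0n // Eq; apply: mono.
    by rewrite -truncn_ge_nat // ltW.
  apply: ler_wpM2l => //; apply: le_trans (prime_recip_sum_homo MN) _.
  apply: le_trans (prime_recip_sum_le_ln N1) _.
  by rewrite ler_ln ?posrE ?ltr0n // truncn_le ltW.
rewrite split big_nat_cond [leRHS]big_nat_cond.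
apply: ler_sum => p /andP[/andP[_ px] pp].
rewrite ler_piMl ?invr_ge0 ?ler0n //.
have := mono p x; rewrite divff ?gt_eqF // powR1; apply.
by rewrite -truncn_ge_nat // ltW.
Qed.

Lemma prime_power_sum_small (c : R) : 0 < c + 1 ->
  prime_power_sum c x / x `^ (c + 1) @[x --> +oo] --> 0.
Proof.
move=> c0; apply/cvgr0Pnorm_le => e e0.
(* Chosen so that d < 1 and the limit - ln d of the upper bound is e/2 < e. *)
pose d := expR (- (e / 2)).
have d0 : 0 < d by exact: expR_gt0.
have d1 : d < 1 by rewrite expR_lt1; lra.
have cg : x `^ (- ((1 - d) * (c + 1))) * ln x + (P x - P (x `^ d)) @[x --> +oo]
    --> 0 + - ln d.
  apply: cvgD; last exact: prime_recip_sum_powR.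
  by apply: cvgr_ln_powR; rewrite mulr_gt0 //; lra.
have lim_lt : 0 + - ln d < e by rewrite expRK; lra.
near=> x.
have x1 : 1 <= x by near: x; exact: nbhs_pinfty_ge (num_real _).
rewrite ger0_norm; last first.
  by rewrite divr_ge0 ?powR_ge0 // /prime_power_sum sumr_ge0 // => p _.
have dd : 0 < d < 1 by rewrite d0 d1.
apply: le_trans (prime_power_sum_le c0 dd x1) _.
by near: x; exact: cvgr_le cg _ lim_lt.
Unshelve. all: by end_near. Qed.

End PrimeSums.

(** * Integration of step functions against a power *)

Section StepIntegral.
Variable R : realType.
Local Notation mu := (@lebesgue_measure R).

Lemma powR_within_continuous (e a x : R) : 0 < a ->
  {within `[a, x], continuous (fun t : R => t `^ e)}.
Proof.
move=> a0; apply: derivable_within_continuous => t.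
rewrite in_itv /= => /andP[at_ _].
apply: derivable_powR; rewrite in_itv /= andbT; exact: lt_le_trans at_.
Qed.

Lemma integrable_powR (e a x : R) : 0 < a ->
  mu.-integrable `[a, x] (EFin \o (fun t : R => t `^ e)).
Proof.
move=> a0; apply: continuous_compact_integrable; first exact: segment_compact.
exact: powR_within_continuous.
Qed.

Lemma Rintegral_powR (m a x : R) : 0 < m -> 0 < a -> a <= x ->
  \int[mu]_(t in `[a, x]) t `^ (- (m + 1)) = (a `^ (- m) - x `^ (- m)) / m.
Proof.
move=> m0 a0; rewrite le_eqVlt => /predU1P[<-|ax].
  (* On the one-point interval both sides are 0; the fundamental theorem of calculus covers a <
     x. *)
  by rewrite set_itv1 Rintegral_set1 subrr mul0r.
pose F (t : R) : R := - m^-1 * t `^ (- m).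
have dF (t : R) : 0 < t -> is_derive t 1 F (t `^ (- (m + 1))).
  move=> t0; have -> : t `^ (- (m + 1)) = - m^-1 *: (- m * t `^ (- m - 1) : R^o).
    by rewrite opprD /GRing.scale /=; field; rewrite gt_eqF.
  exact: (@is_deriveZ R R^o R^o (fun t : R => t `^ (- m)) (- m^-1) t 1 _
      (is_derive1_powR (- m) t0)).
have cF (t : R) : 0 < t -> {for t, continuous F}.
  move=> t0; apply/differentiable_continuous/derivable1_diffP.
  by case: (dF t t0).
rewrite /Rintegral (@continuous_FTC2 _ _ F) //.
- by rewrite /= /F; field; rewrite gt_eqF.
- exact: powR_within_continuous.
- split.
  + move=> t; rewrite in_itv /= => /andP[at_ _].
    by case: (dF t (lt_trans a0 at_)).
  + by apply: cvg_at_right_filter; exact: cF.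
  + by apply: cvg_at_left_filter; apply: cF; exact: lt_trans ax.
- move=> t; rewrite in_itv /= => /andP[at_ _].
  by rewrite derive1E; case: (dF t (lt_trans a0 at_)).
Qed.

(** A jump of height [w p] at [a p] contributes [w p] times the integral over [a p, x].
    Integrability is proved along with the value because additivity of the integral depends on
    it. *)
Lemma integral_step_powR (m x : R) (s : seq nat) (w a : nat -> R) :
    0 < m -> {in s, forall p, 1 <= a p <= x} ->
  let f t := (\sum_(p <- s) if a p <= t then w p else 0) * t `^ (- (m + 1)) in
  mu.-integrable `[1, x] (EFin \o f) /\
  \int[mu]_(t in `[1, x]) f t =
    \sum_(p <- s) w p * ((a p `^ (- m) - x `^ (- m)) / m).
Proof.
move=> m0; elim: s => [|p s IH] /= ap.
  have -> : (fun t => (\sum_(p <- [::]) if a p <= t then w p else 0) *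
      t `^ (- (m + 1))) = cst 0.
    by apply/funext => t; rewrite big_nil mul0r.
  by rewrite big_nil Rintegral_cst // mul0r; split => //; exact: integrable0.
have /andP[p1 px] := ap p (mem_head _ _).
have [I1 I2] : mu.-integrable `[1, x] (EFin \o
    (fun t => (\sum_(p <- s) if a p <= t then w p else 0) * t `^ (- (m + 1)))) /\
    \int[mu]_(t in `[1, x]) ((\sum_(p <- s) if a p <= t then w p else 0) * t `^ (- (m + 1)))
     = \sum_(p <- s) w p * ((a p `^ (- m) - x `^ (- m)) / m).
  by apply: IH => q qs; apply: ap; rewrite inE qs orbT.
pose g (t : R) : R := t `^ (- (m + 1)).
have a0 : 0 < a p by exact: lt_le_trans p1.
have sub : `[1, x]%classic `&` `[a p, x]%classic = `[a p, x]%classic :> set R.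
  apply/seteqP; split=> [t []//|t] /=; rewrite !in_itv /=.
  by move=> /andP[h1 h2]; rewrite h1 h2 (le_trans p1 h1).
(* One jump as an extension by zero, whose integral over [1, x] is that of [g] over [a p, x]. *)
pose h := g \_ `[a p, x].
have ig : mu.-integrable `[a p, x] (EFin \o g) by exact: integrable_powR.
have ih : mu.-integrable `[1, x] (EFin \o h).
  rewrite /h -restrict_EFin; apply/integrable_restrict => //.
  by rewrite sub.
have iwh : mu.-integrable `[1, x] (EFin \o (fun t => w p * h t)).
  exact: (integrableZl _ (w p) ih).
have E (t : R) : t \in `[1, x]%classic ->
    w p * h t + (\sum_(p <- s) if a p <= t then w p else 0) * t `^ (- (m + 1))
    = (\sum_(p <- p :: s) if a p <= t then w p else 0) * t `^ (- (m + 1)).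
  rewrite inE /= in_itv /= => /andP[t1 tx].
  rewrite big_cons mulrDl; congr (_ + _).
  rewrite /h patchE; have [pt|pt] := leP (a p) t.
    by rewrite mem_set //= in_itv /= pt tx.
  by rewrite memNset ?mulr0 ?mul0r //= in_itv /= leNgt pt.
split.
  apply: (@eq_integrable _ _ _ mu _ _ (EFin \o (fun t => w p * h t +
   (\sum_(p <- s) if a p <= t then w p else 0) * t `^ (- (m + 1))))) => //.
    by move=> t tI; rewrite /= E.
  exact: integrableD iwh I1.
under eq_Rintegral => t tI do rewrite -E //.
rewrite RintegralD // I2 big_cons RintegralZl //.
by rewrite /h -Rintegral_mkcondr sub Rintegral_powR.
Qed.

(** A fixed index set turns a sum with a moving cutoff y into a step function of y. *)
Lemma primes_upto_widen (F : nat -> R) (y z : R) : 0 <= y -> y <= z ->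
  \sum_(p <- primes_upto y) F p =
  \sum_(p <- primes_upto z) if p%:R <= y then F p else 0.
Proof.
move=> y0 yz; rewrite !primes_upto_sum.
rewrite [RHS](@big_cat_nat _ _ _ (Num.truncn y).+1) //=; last first.
  by rewrite ltnS le_truncn.
rewrite [X in _ = _ + X]big_nat_cond [X in _ = _ + X]big1 ?addr0.
  rewrite big_nat_cond [RHS]big_nat_cond; apply: eq_bigr => p /andP[/andP[_ py] _].
  by rewrite -truncn_ge_nat // -ltnS py.
move=> p /andP[/andP[py _] _].
by rewrite ifF // -truncn_ge_nat // leqNgt py.
Qed.

Lemma prime_power_sum0 (y : R) : prime_power_sum 0 y = (prime_pi y)%:R.
Proof.
rewrite /prime_power_sum /prime_pi -sum1_size natr_sum.
by apply: eq_bigr => p _; rewrite powRr0.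
Qed.

Lemma mem_primes_upto (p : nat) (x : R) : 0 <= x ->
  (p \in primes_upto x) = prime p && (p%:R <= x).
Proof.
by move=> x0; rewrite mem_filter mem_iota /= add0n ltnS truncn_ge_nat.
Qed.

(** Locates the jumps of pi(t^m) at the points p^(1/m). *)
Lemma le_powR_root (m y t : R) : 0 < m -> 0 <= y -> 0 <= t ->
  (y `^ m^-1 <= t) = (y <= t `^ m).
Proof.
move=> m0 y0 t0; apply/idP/idP => h.
  have := @ge0_ler_powR _ m (ltW m0) _ _ (powR_ge0 y m^-1) t0 h.
  by rewrite -powRrM mulVf ?gt_eqF // powRr1.
have im0 : 0 <= m^-1 by rewrite invr_ge0 ltW.
have := @ge0_ler_powR _ _ im0 _ _ y0 (powR_ge0 t m) h.
by rewrite -powRrM mulfV ?gt_eqF // powRr1.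
Qed.

End StepIntegral.

(** * Evaluation of the integral and its limit *)

Section Discrepancy.
Variables (R : realType) (k : R).
Hypothesis hk : -1 < k.
Local Notation mu := (@lebesgue_measure R).
Local Notation S := (@prime_recip_sum R).
Local Notation P x := (S (Num.truncn (x : R))).
Let m : R := k + 1.
Let m0 : 0 < m. Proof. by rewrite /m -ltrBlDr sub0r. Qed.

Let f (t : R) : R :=
  (prime_power_sum k t - (prime_pi (t `^ m))%:R) / t `^ (k + 2).

(** The jumps are p^k at p and 1 at p^(1/m). Their lower endpoints give p^k p^(-m) = 1/p and
    (p^(1/m))^(-m) = 1/p, hence the two reciprocal sums; the endpoint x gives the remaining
    terms. *)
Lemma discrepancy_integral (x : R) : 1 <= x ->
  mu.-integrable `[1, x] (EFin \o f) /\
  \int[mu]_(t in `[1, x]) f t =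
    (P x - P (x `^ m) - prime_power_sum k x / x `^ m
      + prime_power_sum 0 (x `^ m) / x `^ m) / m.
Proof.
move=> x1; have x0 : 0 < x by exact: lt_le_trans x1.
have X1 : 1 <= x `^ m by rewrite -(powRr0 x) ler_powR // ltW.
have [|A1 A2] := @integral_step_powR R m x (primes_upto x) (fun p => p%:R `^ k)
  (fun p => p%:R) m0.
  move=> p; rewrite mem_primes_upto ?(ltW x0) // => /andP[pp ->].
  by rewrite ler1n prime_gt0.
have [|B1 B2] := @integral_step_powR R m x (primes_upto (x `^ m)) (fun p => 1)
  (fun p => p%:R `^ m^-1) m0.
  move=> p; rewrite mem_primes_upto ?powR_ge0 // => /andP[pp px].
  rewrite le_powR_root ?ler0n ?(ltW x0) // px andbT.
  by rewrite -[leLHS](powRr0 p%:R) ler_powR ?invr_ge0 ?(ltW m0) // ler1n prime_gt0.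
have E (t : R) : t \in `[1, x]%classic ->
   (\sum_(p <- primes_upto x) if p%:R <= t then p%:R `^ k else 0) * t `^ (- (m + 1))
  - (\sum_(p <- primes_upto (x `^ m)) if p%:R `^ m^-1 <= t then 1 else 0) * t `^ (- (m + 1)) = f t.
  rewrite inE /= in_itv /= => /andP[t1 tx].
  have t0 : 0 <= t by lra.
  rewrite -mulrBl /f -prime_power_sum0 powRN /m.
  have -> : k + 1 + 1 = k + 2 by lra.
  congr (_ / _); rewrite -/m /prime_power_sum; congr (_ - _).
    by rewrite -primes_upto_widen.
  rewrite (@primes_upto_widen _ _ (t `^ m) (x `^ m)) ?powR_ge0 //; last first.
    by apply: ge0_ler_powR; rewrite ?nnegrE ?(ltW m0) ?(ltW x0).
  by apply: eq_bigr => p _; rewrite le_powR_root ?ler0n // powRr0.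
split.
  apply: (@eq_integrable _ _ _ mu _ _ (EFin \o (fun t =>
   (\sum_(p <- primes_upto x) if p%:R <= t then p%:R `^ k else 0) * t `^ (- (m + 1))
  - (\sum_(p <- primes_upto (x `^ m)) if p%:R `^ m^-1 <= t then 1 else 0) * t `^ (- (m + 1)))))
     => //.
    by move=> t tI; rewrite /= E.
  exact: integrableB A1 B1.
under eq_Rintegral => t tI do rewrite -E //.
rewrite RintegralB // A2 B2.
have -> : \sum_(p <- primes_upto x) p%:R `^ k * ((p%:R `^ (- m) - x `^ (- m)) / m)
  = (P x - prime_power_sum k x / x `^ m) / m.
  rewrite /prime_recip_sum -primes_upto_sum /prime_power_sum mulr_suml -sumrB mulr_suml.
  rewrite big_seq [RHS]big_seq; apply: eq_bigr => p.
  rewrite mem_primes_upto ?(ltW x0) // => /andP[pp _].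
  have p0 : 0 < p%:R :> R by rewrite ltr0n prime_gt0.
  rewrite mulrA mulrBr -powRD ?(gt_eqF p0) ?implybT // powRN; congr ((_ - _) / _).
  have -> : k - m = -1 by rewrite /m; lra.
  by rewrite powR_inv1 // ltW.
have -> : \sum_(p <- primes_upto (x `^ m)) 1 * (((p%:R `^ m^-1) `^ (- m) - x `^ (- m)) / m)
  = (P (x `^ m) - prime_power_sum 0 (x `^ m) / x `^ m) / m.
  rewrite /prime_recip_sum -primes_upto_sum /prime_power_sum mulr_suml -sumrB mulr_suml.
  apply: eq_bigr => p _.
  rewrite mul1r -powRrM mulrN mulVf ?gt_eqF // powR_inv1 ?ler0n // powRr0 mul1r.
  by rewrite powRN.
ring.
Qed.

Lemma discrepancy_improper_integral :
  improper_integral_eq f 1 (- 1 / m * ln m).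
Proof.
split=> [x|].
  have [x1|x1] := leP 1 x; first by case: (discrepancy_integral x1).
  rewrite set_itv_ge; first exact: integrable_set0.
  by rewrite bnd_simp -ltNge.
(* This is pi(y)/y -> 0 along y = x^m, the exponent 0 case of [prime_power_sum_small]. *)
have Q0 : prime_power_sum 0 (x `^ m) / x `^ m @[x --> +oo] --> (0 : R).
  have := @prime_power_sum_small R 0; rewrite add0r => /(_ ltr01).
  move=> /(cvg_comp _ _ (cvgr_powR m0)); apply: cvg_trans; apply: near_eq_cvg.
  by near=> x; rewrite /= powRr1 // powR_ge0.
have : (P x - P (x `^ m) - prime_power_sum k x / x `^ m
      + prime_power_sum 0 (x `^ m) / x `^ m) / m @[x --> +oo] -->
   (- ln m - 0 + 0) / m.
  apply: cvgMr_tmp; apply: cvgD Q0; apply: cvgB; first exact: prime_recip_sum_powR.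
  exact: prime_power_sum_small.
have -> : (- ln m - 0 + 0) / m = - 1 / m * ln m by ring.
apply: cvg_trans; apply: near_eq_cvg; near=> x.
have x1 : 1 <= x by near: x; exact: nbhs_pinfty_ge (num_real _).
by have [_ ->] := discrepancy_integral x1.
Unshelve. all: by end_near. Qed.

End Discrepancy.

Theorem theorem2 (R : realType) (k : R) (hk : -1 < k) :
  improper_integral_eq
    (fun t : R =>
       (prime_power_sum k t - (prime_pi (t `^ (k + 1)))%:R) / t `^ (k + 2))
    1 (- 1 / (k + 1) * ln (k + 1)) /\
  (0 < k -> - 1 / (k + 1) * ln (k + 1) < 0) /\
  (k < 0 -> 0 < - 1 / (k + 1) * ln (k + 1)).
Proof.
split; first exact: discrepancy_improper_integral.
(* The value thus has the sign opposite to that of ln (k+1). *)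
have c0 : - 1 / (k + 1) < 0 by rewrite mulN1r oppr_lt0 invr_gt0; lra.
split=> k0.
  by rewrite nmulr_rlt0 // ln_gt0; lra.
by rewrite nmulr_rgt0 // ln_lt0; lra.
Qed.
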